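(* Let $\mathbf{R}$ be a real closed field, let $a, b \in \mathbf{R}$ with $a < b$ and let $P, Q \in \mathbf{R}[X]$ with $P\neq 0$ and $\deg Q = q < \deg P = p$. If $a$ and $b$ are not common roots of $P$ and $Q$ (i.e. neither $a$ nor $b$ is a common root of $P$ and $Q$) and $(S_0, \dots, S_s)$ is the Sturm sequence of $P$ and $Q$, then $$ \mathrm{Ind}_a^b\Big(\frac{Q}{P}\Big) = \sum_{0 \le i \le s-1} \mathrm{Var}_a^b(S_{i}, S_{i+1}). $$
   Context: $\mathbf{R}$ is a real closed field; $\mathrm{sign}(y)\in\{-1,0,1\}$ is the sign of $y \in \mathbf{R}$. $Q=0$ is allowed (with $\deg 0=-\infty$). **Cauchy index.** Let $x\in\mathbf{R}$ and $F,G\in\mathbf{R}[X]\setminus\{0\}$. Write uniquely $\frac{G}{F} = (X-x)^m \frac{\widetilde G}{\widetilde F}$ with $m\in\mathbb{Z}$, $\widetilde F$ monic, $\widetilde F,\widetilde G \in \mathbf{R}[X]$ coprime, $\widetilde F(x)\neq 0$, $\widetilde G(x)\ne 0$. If $m<0$, set $\mathrm{Ind}_x^+(\frac GF)=\frac12\mathrm{sign}\big(\frac{\widetilde G(x)}{\widetilde F(x)}\big)$ and $\mathrm{Ind}_x^-(\frac GF)=\frac12(-1)^m\mathrm{sign}\big(\frac{\widetilde G(x)}{\widetilde F(x)}\big)$; if $m\ge 0$, both are $0$. Set $\mathrm{Ind}_x(\frac GF)=\mathrm{Ind}_x^+(\frac GF)-\mathrm{Ind}_x^-(\frac GF)$.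 For $a<b$ in $\mathbf{R}$, $$\mathrm{Ind}_a^b\Big(\frac GF\Big)=\mathrm{Ind}_a^+\Big(\frac GF\Big)+\sum_{x\in(a,b)}\mathrm{Ind}_x\Big(\frac GF\Big)-\mathrm{Ind}_b^-\Big(\frac GF\Big)$$ (only the finitely many roots of $F$ in $(a,b)$ contribute). If $G=0$, $\mathrm{Ind}_a^b(\frac GF)=0$. **Sign variation.** For $x\in\mathbf{R}$ and $F,G\in\mathbf{R}[X]$, $\mathrm{Var}_x(F,G)=\frac12\big|\mathrm{sign}(F(x))-\mathrm{sign}(G(x))\big|$, and for $a<b$, $\mathrm{Var}_a^b(F,G)=\mathrm{Var}_a(F,G)-\mathrm{Var}_b(F,G)$. **Sturm sequence.** For $P\ne 0$ and $Q\neq0$: $S_0=P$, $S_1=Q$, $S_{i+1}=-\mathrm{Rem}(S_{i-1},S_i)$ (remainder of the Euclidean division of $S_{i-1}$ by $S_i$), and $s$ is the index such that $S_1,\dots,S_s\neq0$ and $S_{s+1}=0$; the Sturm sequence of $P$ and $Q$ is $(S_0,\dots,S_s)$. The Sturm sequence of $P$ and $0$ is $(S_0)=(P)$, with $s=0$. *)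

(* Defs.v *)
From mathcomp Require Import all_boot all_order all_algebra.
From mathcomp Require Import ring.
From mathcomp Require Import polyorder polyrcf.

Set Implicit Arguments.
Unset Strict Implicit.
Unset Printing Implicit Defensive.

Import Order.TTheory GRing.Theory Num.Theory.
Local Open Scope ring_scope.

(* G / F = ('X - x)^m * (G' / F') in the field of rational functions, where
   m = local_val x G F, F' = local_den x G F and G' = local_num x G F;
   [local_formP] and [local_form_uniq] state that this is the unique such
   decomposition with F' monic, F' and G' coprime and not vanishing at x. *)

Definition strip (R : rcfType) (x : R) (F : {poly R}) : {poly R} :=
  F %/ ('X - x%:P) ^+ \mu_x F.

Definition local_val (R : rcfType) (x : R) (G F : {poly R}) : int :=
  (\mu_x G)%:Z - (\mu_x F)%:Z.

Definition local_red (R : rcfType) (x : R) (G F : {poly R}) : {poly R} :=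
  strip x F %/ gcdp (strip x G) (strip x F).

Definition local_den (R : rcfType) (x : R) (G F : {poly R}) : {poly R} :=
  (lead_coef (local_red x G F))^-1 *: local_red x G F.

Definition local_num (R : rcfType) (x : R) (G F : {poly R}) : {poly R} :=
  (lead_coef (local_red x G F))^-1 *:
    (strip x G %/ gcdp (strip x G) (strip x F)).

Definition is_local_form (R : rcfType) (x : R) (G F : {poly R})
    (m : int) (G' F' : {poly R}) : Prop :=
  [/\ tofrac G / tofrac F
        = tofrac ('X - x%:P) ^ m * (tofrac G' / tofrac F')
        :> {fraction {poly R}},
      F' \is monic,
      coprimep F' G',
      F'.[x] != 0
    & G'.[x] != 0].

Definition sgq (R : rcfType) (y : R) : rat := (sgz y)%:~R.

Definition Ind_right (R : rcfType) (x : R) (G F : {poly R}) : rat :=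
  if local_val x G F < 0 then
    2^-1 * sgq ((local_num x G F).[x] / (local_den x G F).[x])
  else 0.

Definition Ind_left (R : rcfType) (x : R) (G F : {poly R}) : rat :=
  if local_val x G F < 0 then
    2^-1 * (-1) ^ (local_val x G F)
         * sgq ((local_num x G F).[x] / (local_den x G F).[x])
  else 0.

Definition Ind_at (R : rcfType) (x : R) (G F : {poly R}) : rat :=
  Ind_right x G F - Ind_left x G F.

(* [roots F a b] enumerates without repetition the roots of F != 0 in the open
   interval ]a, b[; other points do not contribute, see [Ind_at_noroot]. *)
Definition cauchy_index (R : rcfType) (a b : R) (G F : {poly R}) : rat :=
  if G == 0 then 0
  else Ind_right a G F + \sum_(x <- roots F a b) Ind_at x G F - Ind_left b G F.

Definition Var_at (R : rcfType) (x : R) (F G : {poly R}) : rat :=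
  2^-1 * `|sgq F.[x] - sgq G.[x]|.

Definition Var_between (R : rcfType) (a b : R) (F G : {poly R}) : rat :=
  Var_at a F G - Var_at b F G.

(* Only meaningful up to the first index i >= 1 whose term vanishes:
   [p %% 0 = p], so later terms are junk. *)
Fixpoint sturm_term (R : rcfType) (P Q : {poly R}) (n : nat) : {poly R} :=
  match n with
  | 0 => P
  | 1 => Q
  | (k.+1 as l).+1 => - (sturm_term P Q k %% sturm_term P Q l)
  end.

Definition is_sturm_seq (R : rcfType) (P Q : {poly R}) (S : seq {poly R}) : Prop :=
  exists s : nat,
    [/\ S = mkseq (sturm_term P Q) s.+1,
        forall i : nat, (1 <= i <= s)%N -> sturm_term P Q i != 0
      & sturm_term P Q s.+1 = 0].

Lemma stripE (R : rcfType) (x : R) (F : {poly R}) :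
  F = strip x F * ('X - x%:P) ^+ \mu_x F.
Proof. by rewrite /strip divpK // root_mu. Qed.

Lemma strip_neq0 (R : rcfType) (x : R) (F : {poly R}) :
  F != 0 -> (strip x F).[x] != 0.
Proof.
move=> F0; have [q qx e] := mu_spec x F0.
have Xn0 : ('X - x%:P) ^+ \mu_x F != 0 :> {poly R}.
  by rewrite expf_neq0 // polyXsubC_eq0.
by rewrite /strip {1}e mulpK.
Qed.

Lemma frac_split (K : fieldType) (t y z u v : K) (m n : nat) :
  t != 0 -> y != 0 -> u != 0 -> v != 0 ->
  z * u * t ^+ m / (y * u * t ^+ n) = t ^ (m%:Z - n%:Z) * (v * z / (v * y)).
Proof.
move=> t0 y0 u0 v0; rewrite expfzDr // -invr_expz -!exprnP.
by field; rewrite expf_neq0 // y0 u0 v0.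
Qed.

Lemma frac_cross (K : fieldType) (t g1 f1 g2 f2 : K) (m : int) (k : nat) :
  t != 0 -> f1 != 0 -> f2 != 0 ->
  t ^ m * (g1 / f1) = t ^ (m + k%:Z) * (g2 / f2) ->
  g1 * f2 = t ^+ k * g2 * f1.
Proof.
move=> t0 f10 f20; rewrite expfzDr // -mulrA.
move/(mulfI (expfz_neq0 m t0)); rewrite -exprnP mulrA.
by move/eqP; rewrite eqr_div // => /eqP.
Qed.

Lemma tofrac_split (D : idomainType) (t y z u v : D) (m n : nat) :
  t != 0 -> y != 0 -> u != 0 -> v != 0 ->
  tofrac (z * u * t ^+ m) / tofrac (y * u * t ^+ n) =
    tofrac t ^ (m%:Z - n%:Z) * (tofrac (v * z) / tofrac (v * y))
    :> {fraction D}.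
Proof.
move=> t0 y0 u0 v0; rewrite !tofracM !tofracXn.
have H := @frac_split {fraction D} (tofrac t) (tofrac y) (tofrac z)
  (tofrac u) (tofrac v) m n.
by rewrite H ?tofrac_eq0.
Qed.

Lemma tofrac_cross (D : idomainType) (t g1 f1 g2 f2 : D) (m : int) (k : nat) :
  t != 0 -> f1 != 0 -> f2 != 0 ->
  tofrac t ^ m * (tofrac g1 / tofrac f1) =
    tofrac t ^ (m + k%:Z) * (tofrac g2 / tofrac f2) :> {fraction D} ->
  g1 * f2 = t ^+ k * g2 * f1.
Proof.
move=> t0 f10 f20 e; apply/eqP; rewrite -tofrac_eq !tofracM tofracXn; apply/eqP.
have H := @frac_cross {fraction D} (tofrac t) (tofrac g1) (tofrac f1)
  (tofrac g2) (tofrac f2) m k.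
by rewrite H ?tofrac_eq0.
Qed.

Lemma local_formP (R : rcfType) (x : R) (G F : {poly R}) :
  F != 0 -> G != 0 ->
  is_local_form x G F (local_val x G F) (local_num x G F) (local_den x G F).
Proof.
move=> F0 G0; have Fx := strip_neq0 x F0; have Gx := strip_neq0 x G0.
have EF := stripE x F; have EG := stripE x G.
rewrite /local_num /local_den /local_red /local_val.
move: (strip x F) (strip x G) Fx Gx EF EG => f g fx gx EF EG.
set d := gcdp g f.
have f0 : f != 0 by apply: contraNneq fx => ->; rewrite horner0.
have Ef : f = (f %/ d) * d by rewrite divpK // dvdp_gcdr.
have Eg : g = (g %/ d) * d by rewrite divpK // dvdp_gcdl.
have cop : coprimep (f %/ d) (g %/ d).
  by rewrite coprimep_sym coprimep_div_gcd // f0 orbT.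
move: (f %/ d) (g %/ d) Ef Eg cop => f1 g1 Ef Eg cop.
have f1x : f1.[x] != 0.
  by apply: contraNneq fx => e; rewrite Ef hornerM e mul0r.
have g1x : g1.[x] != 0.
  by apply: contraNneq gx => e; rewrite Eg hornerM e mul0r.
have f10 : f1 != 0 by apply: contraNneq f1x => ->; rewrite horner0.
have d0 : d != 0 by apply: contraNneq f0 => e; rewrite Ef e mulr0.
have c0 : (lead_coef f1)^-1 != 0 by rewrite invr_eq0 lead_coef_eq0.
split.
- rewrite {1}EF {1}EG Ef Eg -!mul_polyC.
  by apply: tofrac_split; rewrite ?polyXsubC_eq0 ?polyC_eq0.
- by rewrite monicE lead_coefZ mulVf // lead_coef_eq0.
- by rewrite coprimepZl // coprimepZr.
- by rewrite hornerZ mulf_neq0.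
- by rewrite hornerZ mulf_neq0.
Qed.

Lemma local_form_uniq (R : rcfType) (x : R) (G F : {poly R})
    (m n : int) (G1 F1 G2 F2 : {poly R}) :
  is_local_form x G F m G1 F1 -> is_local_form x G F n G2 F2 ->
  [/\ m = n, G1 = G2 & F1 = F2].
Proof.
wlog le_mn : m n G1 F1 G2 F2 / m <= n => [W h1 h2|].
  have [le_mn|/ltW le_nm] := lerP m n; first exact: W h1 h2.
  by have [-> -> ->] := W _ _ _ _ _ _ le_nm h2 h1.
move=> [e1 mon1 cop1 f1x g1x] [e2 mon2 cop2 f2x g2x].
have [k En] : exists k : nat, n = m + k%:Z.
  exists `|(n - m)%R|%N; rewrite gez0_abs ?subr_ge0 //.
  by rewrite [RHS]addrC subrK.
have E : G1 * F2 = ('X - x%:P) ^+ k * G2 * F1.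
  by apply: (@tofrac_cross _ _ _ _ _ _ m);
    rewrite ?polyXsubC_eq0 ?monic_neq0 // -En -e1 -e2.
have k0 : k = 0%N.
  case: k {En} E => // k /(congr1 (fun p => p.[x])) /eqP.
  rewrite !hornerE subrr expr0n !mul0r mulf_eq0.
  by rewrite (negPf g1x) (negPf f2x).
rewrite k0 expr0 mul1r in E; rewrite En k0 addr0.
have EF : F1 = F2.
  apply/eqP; rewrite -eqp_monic //; apply/andP; split.
    by rewrite -(Gauss_dvdpr _ cop1) E dvdp_mull.
  by rewrite -(Gauss_dvdpr _ cop2) -E dvdp_mull.
split=> //; move: E; rewrite EF => /mulIf; apply.
exact: monic_neq0.
Qed.

Lemma Ind_at_noroot (R : rcfType) (x : R) (G F : {poly R}) :
  ~~ root F x -> Ind_at x G F = 0.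
Proof.
move=> nFx; have : ~~ (local_val x G F < 0).
  by rewrite /local_val (muNroot nFx) subr0.
by rewrite /Ind_at /Ind_right /Ind_left => /negPf ->; rewrite subr0.
Qed.

Lemma is_sturm_seq_ex (R : rcfType) (P Q : {poly R}) :
  exists S : seq {poly R}, is_sturm_seq P Q S.
Proof.
have ex : exists n, sturm_term P Q n.+1 == 0.
  have [N leN] := ubnP (size Q).
  suff H : forall N k, (size (sturm_term P Q k.+1) < N)%N ->
      exists n, sturm_term P Q n.+1 == 0 by exact: (H N 0%N).
  move=> {N leN}; elim=> // N IH k; rewrite ltnS => le.
  have [e|ne] := eqVneq (sturm_term P Q k.+1) 0; first by exists k; rewrite e.
  apply: (IH k.+1); apply: leq_trans le.
  by rewrite /= size_polyN ltn_modp.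
case: (ex_minnP ex) => s /eqP es mins.
exists (mkseq (sturm_term P Q) s.+1), s; split=> // -[//|i] /= lis.
by apply/negP => /mins; rewrite leqNgt lis.
Qed.

Lemma is_sturm_seq_uniq (R : rcfType) (P Q : {poly R}) (S1 S2 : seq {poly R}) :
  is_sturm_seq P Q S1 -> is_sturm_seq P Q S2 -> S1 = S2.
Proof.
move=> [s [-> n1 z1]] [t [-> n2 z2]]; case: (ltngtP s t) => [lt|lt|-> //].
  by have := n2 s.+1 lt; rewrite z1 eqxx.
by have := n1 t.+1 lt; rewrite z2 eqxx.
Qed.

(* Main.v *)
Require Import Defs.
From mathcomp Require Import all_boot all_order all_algebra.
From mathcomp Require Import ring lra.
From mathcomp Require Import polyorder polyrcf.

Set Implicit Arguments.
Unset Strict Implicit.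
Unset Printing Implicit Defensive.

Import Order.TTheory GRing.Theory Num.Theory.
Local Open Scope ring_scope.

(** The sum of variations along a Sturm sequence is obtained by iterating one
    step of the Euclidean algorithm, which rests on two properties of the
    Cauchy index.

    - Inversion ([cauchy_index_inversion]): if F and G have no common root at a
      or b, then Ind(G/F) + Ind(F/G) = Var(F, G), all taken between a and b.
    - Invariance ([cauchy_index_rem]): adding a polynomial to G/F does not
      change its poles or its signs near them, so Ind(- Rem(G, F)/F) is
      - Ind(G/F).

    Together they give Ind(S1/S0) = Var(S0, S1) + Ind(S2/S1), and the induction
    of [cauchy_index_sturm] ends with Ind(0/S_s) = 0. The endpoint hypothesis is
    inherited along the way: a common root of S1 and S2 is also a common root of
    S0 and S1.

    Inversion is local. Let e be the sign of FG immediately to the right of x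
    (or immediately to the left). Of G/F and F/G at most one has a pole at x,
    exactly when the multiplicities of x in F and G differ, and its one-sided
    index is then e/2, whichever of the two it is ([Ind_rightE],
    [Ind_leftE]). Consequently:

    - at every x, the two full indices add up to half the sign jump of FG across
      x: when the multiplicities agree, FG has even order at x and there is no
      jump ([Ind_at_inversion]). Over the interior these jumps telescope
      ([sum_sign_jumps]), which leaves half the difference between the sign of
      FG just before b and the one just after a;
    - at an endpoint, which is not a common root, the one-sided indices add up
      to the variation at that point minus the variation next to it, the latter
      being (1 - e)/2 ([Ind_right_inversion], [Ind_left_inversion]).

    The terms in e cancel and the variations at a and b remain. *)

(** * One-sided signs of a polynomial at a point *)

Definition sign_after (R : rcfType) (x : R) (F : {poly R}) : rat :=
  sgq (sgp_right F x).

(** A polynomial changes sign across x exactly when x has odd multiplicity. *)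
Definition sign_before (R : rcfType) (x : R) (F : {poly R}) : rat :=
  (-1) ^+ \mu_x F * sign_after x F.

Lemma sgqM (R : rcfType) (y z : R) : sgq (y * z) = sgq y * sgq z.
Proof. by rewrite /sgq sgzM intrM. Qed.

Lemma sgq_sgr (R : rcfType) (y : R) : sgq (Num.sg y) = sgq y.
Proof. by rewrite /sgq sgz_sgr. Qed.

Lemma sgq_cases (R : rcfType) (y : R) :
  y != 0 -> sgq y = 1 \/ sgq y = -1.
Proof. by rewrite /sgq; case: sgzP => //= _ _; [left | right]. Qed.

Lemma sgqV (R : rcfType) (y : R) : sgq y^-1 = sgq y.
Proof. by rewrite /sgq !sgz_def invr_eq0 invr_lt0. Qed.

Lemma sign_afterM (R : rcfType) (x : R) (F G : {poly R}) :
  sign_after x (F * G) = sign_after x F * sign_after x G.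
Proof. by rewrite /sign_after sgp_right_mul sgqM. Qed.

Lemma sign_beforeM (R : rcfType) (x : R) (F G : {poly R}) :
  F != 0 -> G != 0 ->
  sign_before x (F * G) = sign_before x F * sign_before x G.
Proof.
move=> F0 G0; rewrite /sign_before sign_afterM mu_mul ?mulf_neq0 // exprD.
by ring.
Qed.

Lemma sign_after_noroot (R : rcfType) (x : R) (F : {poly R}) :
  ~~ root F x -> sign_after x F = sgq F.[x].
Proof. by move=> nFx; rewrite /sign_after sgp_rightNroot // sgq_sgr. Qed.

Lemma sign_before_noroot (R : rcfType) (x : R) (F : {poly R}) :
  ~~ root F x -> sign_before x F = sgq F.[x].
Proof.
by move=> nFx; rewrite /sign_before muNroot // mul1r sign_after_noroot.
Qed.

(** The factor ('X - x) ^ mu removed by [strip] is positive after x; this ties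
    the one-sided sign to the decomposition that defines the index. *)
Lemma sign_after_strip (R : rcfType) (x : R) (F : {poly R}) :
  sign_after x F = sgq (strip x F).[x].
Proof.
have [->|F0] := eqVneq F 0.
  by rewrite /sign_after sgp_right0 /strip div0p horner0.
have X1 n : sgp_right (('X - x%:P) ^+ n) x = 1.
  elim: n => [|n IHn]; first by rewrite expr0 sgp_rightc sgr1.
  rewrite exprS sgp_right_mul IHn mulr1 sgp_right_deriv ?root_XsubC //.
  by rewrite derivXsubC sgp_rightc sgr1.
rewrite /sign_after {1}(stripE x F) sgp_right_mul X1 mulr1.
by rewrite sgp_rightNroot ?sgq_sgr //; apply: strip_neq0.
Qed.

Lemma sign_after_before_noroots (R : rcfType) (a b : R) (F : {poly R}) :
  a < b -> F != 0 -> roots F a b = [::] -> sign_after a F = sign_before b F.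
Proof.
move=> ab F0 nil; have mab : (a + b) / 2 \in `]a, b[.
  by rewrite in_itv /=; apply/andP; split; lra.
have next : next_root F a b = b.
  by rewrite /next_root (negPf F0) nil /=; apply: max_l; apply: ltW.
have prev : prev_root F a b = a.
  by rewrite /prev_root (negPf F0) nil /=; apply: min_l; apply: ltW.
have/sgr_neighpr sa : (a + b) / 2 \in neighpr F a b by rewrite /neighpr next.
have/sgr_neighpl sb : (a + b) / 2 \in neighpl F a b by rewrite /neighpl prev.
rewrite /sign_before /sign_after -sa sb sgqM; congr (_ * _).
by rewrite -[RHS]signr_odd /sgq; case: odd; rewrite ?sgzN sgz1.
Qed.

(** The sign is constant between consecutive roots, so that the sign after one
    root is the sign before the next one and the sum telescopes. *)
Lemma sum_sign_jumps (R : rcfType) (a b : R) (F : {poly R}) :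
  a < b -> F != 0 ->
  \sum_(x <- roots F a b) (sign_after x F - sign_before x F) =
    sign_before b F - sign_after a F.
Proof.
move=> ab F0; move Es: (roots F a b) => s.
elim: s => [|x s IHs] in a ab Es *.
  by rewrite big_nil (sign_after_before_noroots ab F0 Es) subrr.
move/eqP: Es; rewrite roots_cons => /and5P[_ xab /eqP ax _ /eqP xb].
have/andP[ltax ltxb] : a < x < b by move: xab; rewrite in_itv.
rewrite big_cons (IHs x ltxb xb) (sign_after_before_noroots ltax F0 ax).
by ring.
Qed.

(** * The local index as a one-sided sign *)

(** Both sides are the sign of a product of values at x: the common factor d of
    the two stripped polynomials contributes sgq d(x) twice, and the leading
    coefficient used to make the denominator monic also contributes its sign
    twice. *)
Lemma local_quotient_sign (R : rcfType) (x : R) (G F : {poly R}) :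
  F != 0 ->
  sgq ((local_num x G F).[x] / (local_den x G F).[x]) =
    sign_after x (G * F).
Proof.
move=> F0; rewrite sign_afterM !sign_after_strip.
have fx := strip_neq0 x F0; rewrite /local_num /local_den /local_red.
move: (strip x F) (strip x G) fx => f g fx; set d := gcdp g f.
have Ef : f = (f %/ d) * d by rewrite divpK // dvdp_gcdr.
have Eg : g = (g %/ d) * d by rewrite divpK // dvdp_gcdl.
move: (f %/ d) (g %/ d) Ef Eg => f1 g1 Ef Eg.
have [f1x dx] : f1.[x] != 0 /\ d.[x] != 0.
  by apply/andP; move: fx; rewrite Ef hornerM mulf_eq0 negb_or.
have c0 : lead_coef f1 != 0.
  by rewrite lead_coef_eq0; apply: contraNneq f1x => ->; rewrite horner0.
rewrite Ef Eg !hornerE !sgqM !sgqV !sgqM !sgqV.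
have sq (y : R) : y != 0 -> sgq y * sgq y = 1.
  by case/sgq_cases => ->.
have := sq _ dx; have := sq _ c0; move: (sgq _) (sgq _) => u v hu hv.
ring: hu hv.
Qed.

Lemma local_val_lt0 (R : rcfType) (x : R) (G F : {poly R}) :
  (local_val x G F < 0) = (\mu_x G < \mu_x F)%N.
Proof. by rewrite /local_val subr_lt0 ltz_nat. Qed.

Lemma Ind_rightE (R : rcfType) (x : R) (G F : {poly R}) : F != 0 ->
  Ind_right x G F =
    if (\mu_x G < \mu_x F)%N then 2^-1 * sign_after x (G * F) else 0.
Proof.
by move=> F0; rewrite /Ind_right local_val_lt0 local_quotient_sign.
Qed.

Lemma Ind_left_right (R : rcfType) (x : R) (G F : {poly R}) :
  Ind_left x G F = (-1) ^ local_val x G F * Ind_right x G F.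
Proof. by rewrite /Ind_left /Ind_right; case: ifP => _; ring. Qed.

(** In the definition the sign is corrected by (-1) ^ (mu G - mu F), which has
    the parity of the multiplicity mu G + mu F of x in G * F. *)
Lemma Ind_leftE (R : rcfType) (x : R) (G F : {poly R}) :
  G != 0 -> F != 0 ->
  Ind_left x G F =
    if (\mu_x G < \mu_x F)%N then 2^-1 * sign_before x (G * F) else 0.
Proof.
move=> G0 F0; rewrite Ind_left_right Ind_rightE //; case: ifP => _; last first.
  by rewrite mulr0.
rewrite /sign_before mu_mul ?mulf_neq0 // /local_val exprD.
rewrite expfzDr ?oppr_eq0 ?oner_eq0 // -exprnN -exprnP -exprVn invrN1.
by ring.
Qed.

Lemma Ind_0l (R : rcfType) (x : R) (F : {poly R}) :
  (Ind_right x 0 F = 0) * (Ind_left x 0 F = 0).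
Proof.
rewrite Ind_left_right; suff -> : Ind_right x 0 F = 0 by rewrite mulr0.
rewrite /Ind_right /local_num /strip div0p div0p scaler0 horner0 mul0r.
by rewrite /sgq sgz0 mulr0 if_same.
Qed.

(** Stated with divisibility instead of multiplicities so as to cover G = 0,
    whose multiplicity at x is 0 by convention. *)
Lemma Ind_no_pole (R : rcfType) (x : R) (G F : {poly R}) :
  ('X - x%:P) ^+ \mu_x F %| G -> (Ind_right x G F = 0) * (Ind_left x G F = 0).
Proof.
have [->|G0] := eqVneq G 0; first by rewrite !Ind_0l.
rewrite root_le_mu // leqNgt -local_val_lt0 Ind_left_right /Ind_right.
by move=> /negPf ->; rewrite mulr0.
Qed.

(** Only a pole matters. If x is one, then H * F has at x a larger multiplicity
    than G, hence G alone determines both the multiplicity and the sign after x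
    of H * F + G; if G / F has no pole at x, neither does H + G / F. *)
Lemma Ind_modulo (R : rcfType) (x : R) (F G H : {poly R}) : F != 0 ->
  (Ind_right x (H * F + G) F = Ind_right x G F)
  * (Ind_left x (H * F + G) F = Ind_left x G F).
Proof.
move=> F0; set t := ('X - x%:P) ^+ \mu_x F.
have tF : t %| H * F by rewrite dvdp_mull // root_mu.
have [tG|ntG] := boolP (t %| G).
  by rewrite !(Ind_no_pole tG) !Ind_no_pole // dvdp_addr.
have G0 : G != 0 by apply: contraNneq ntG => ->; rewrite dvdp0.
have lt : (\mu_x G < \mu_x F)%N by rewrite ltnNge -root_le_mu.
have [->|H0] := eqVneq H 0; first by rewrite mul0r add0r.
have ltH : (\mu_x G < \mu_x (H * F)%R)%N.
  by rewrite mu_mul ?mulf_neq0 // ltn_addl.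
have muE : \mu_x (H * F + G) = \mu_x G by rewrite mu_addl.
have E : Ind_right x (H * F + G) F = Ind_right x G F.
  by rewrite !Ind_rightE // !sign_afterM muE /sign_after sgp_right_addp0.
by rewrite !Ind_left_right E /local_val muE.
Qed.

Lemma Ind_opp (R : rcfType) (x : R) (F G : {poly R}) : F != 0 ->
  (Ind_right x (- G) F = - Ind_right x G F)
  * (Ind_left x (- G) F = - Ind_left x G F).
Proof.
move=> F0; suff E : Ind_right x (- G) F = - Ind_right x G F.
  by rewrite !Ind_left_right E /local_val mu_opp mulrN.
rewrite !Ind_rightE // mu_opp; case: ifP => _; last by rewrite oppr0.
rewrite mulNr -scaleN1r /sign_after sgp_right_scale sgqM sgrN sgr1.
by rewrite /sgq sgzN sgz1; ring.
Qed.

(** * Exchanging numerator and denominator *)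

(** Meant for e the sign of F * G next to x: then (1 - e) / 2 is the variation
    of (F, G) next to x. If neither polynomial vanishes at x, this is also the
    variation at x; if exactly one does, the variation at x is 1/2. *)
Lemma half_sign_Var (R : rcfType) (x : R) (F G : {poly R}) (e : rat) :
  ~~ (root F x && root G x) ->
  (~~ root F x -> ~~ root G x -> e = sgq F.[x] * sgq G.[x]) ->
  (if root F x || root G x then 2^-1 * e else 0) =
    Var_at x F G - 2^-1 * (1 - e).
Proof.
have sg0 : sgq (0 : R) = 0 by rewrite /sgq sgz0.
rewrite /Var_at !rootE; have [->|Fx] := eqVneq F.[x] 0.
  rewrite sg0 sub0r normrN orTb andTb => /sgq_cases[] -> _;
  by rewrite ?normrN normr1; ring.
have [->|Gx] := eqVneq G.[x] 0 => _.
  rewrite sg0 subr0; case: (sgq_cases Fx) => -> _;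
  by rewrite ?normrN normr1; ring.
move=> /(_ isT isT) ->.
case: (sgq_cases Fx) => ->; case: (sgq_cases Gx) => -> /=;
  by rewrite ?subrr ?opprK -?opprD ?normrN ?normr0 ?ger0_norm; ring.
Qed.

(** When x is not a common root, at least one of its two multiplicities is 0,
    hence they differ exactly when x is a root of F or G. *)
Lemma mu_compare_roots (R : rcfType) (x : R) (F G : {poly R}) (e : rat) :
  F != 0 -> G != 0 -> ~~ (root F x && root G x) ->
  (if (\mu_x G < \mu_x F)%N then e else 0)
    + (if (\mu_x F < \mu_x G)%N then e else 0) =
  if root F x || root G x then e else 0.
Proof.
move=> F0 G0; rewrite -!mu_gt0 //.
case: (ltngtP (\mu_x G) (\mu_x F)) => [lt|lt|->].
- by rewrite (leq_ltn_trans _ lt) //= addr0.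
- by rewrite (leq_ltn_trans _ lt) ?orbT // add0r.
- by rewrite andbb orbb => /negPf ->; rewrite addr0.
Qed.

Lemma Ind_right_inversion (R : rcfType) (x : R) (F G : {poly R}) :
  F != 0 -> G != 0 -> ~~ (root F x && root G x) ->
  Ind_right x G F + Ind_right x F G =
    Var_at x F G - 2^-1 * (1 - sign_after x (F * G)).
Proof.
move=> F0 G0 nFG; rewrite !Ind_rightE // (mulrC G) mu_compare_roots //.
rewrite half_sign_Var // => nF nG.
by rewrite sign_afterM !sign_after_noroot.
Qed.

Lemma Ind_left_inversion (R : rcfType) (x : R) (F G : {poly R}) :
  F != 0 -> G != 0 -> ~~ (root F x && root G x) ->
  Ind_left x G F + Ind_left x F G =
    Var_at x F G - 2^-1 * (1 - sign_before x (F * G)).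
Proof.
move=> F0 G0 nFG; rewrite !Ind_leftE // (mulrC G) mu_compare_roots //.
rewrite half_sign_Var // => nF nG.
by rewrite sign_beforeM // !sign_before_noroot.
Qed.

(** Common roots are harmless at an interior point: equal multiplicities give
    F * G even order at x, hence no sign jump. *)
Lemma Ind_at_inversion (R : rcfType) (x : R) (F G : {poly R}) :
  F != 0 -> G != 0 ->
  Ind_at x G F + Ind_at x F G =
    2^-1 * (sign_after x (F * G) - sign_before x (F * G)).
Proof.
move=> F0 G0; rewrite /Ind_at !Ind_rightE // !Ind_leftE // (mulrC G F).
case: ltngtP => [_|_|e]; try by ring.
rewrite /sign_before mu_mul ?mulf_neq0 // e addnn -signr_odd odd_double.
by ring.
Qed.

Lemma sum_Ind_at_roots (R : rcfType) (a b : R) (F G E : {poly R}) :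
  E != 0 -> F != 0 -> F %| E ->
  \sum_(x <- roots F a b) Ind_at x G F = \sum_(x <- roots E a b) Ind_at x G F.
Proof.
move=> E0 F0 FE.
rewrite (bigID (root F)) /= [X in _ + X]big1 => [|x]; last exact: Ind_at_noroot.
rewrite addr0 [RHS](bigID (root F)) /= [X in _ = _ + X]big1 ?addr0; last first.
  by move=> x; apply: Ind_at_noroot.
rewrite -big_filter -[RHS]big_filter; apply: perm_big; apply: uniq_perm.
- by rewrite filter_uniq ?uniq_roots.
- by rewrite filter_uniq ?uniq_roots.
move=> x; rewrite !mem_filter !in_roots F0 E0.
case rFx: (root F x) => //=.
by rewrite -dvdp_XsubCl (dvdp_trans _ FE) ?dvdp_XsubCl.
Qed.

(** The sum may run over the roots of any nonzero multiple E of F, which puts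
    the indices of G / F and F / G over the same points (E = F * G). *)
Lemma cauchy_indexE (R : rcfType) (a b : R) (G F E : {poly R}) :
  E != 0 -> F != 0 -> F %| E ->
  cauchy_index a b G F =
    Ind_right a G F + \sum_(x <- roots E a b) Ind_at x G F - Ind_left b G F.
Proof.
move=> E0 F0 FE; rewrite /cauchy_index (sum_Ind_at_roots _ _ _ E0 F0 FE).
have [->|//] := eqVneq G 0; rewrite !Ind_0l big1 ?addrK ?subrr // => x _.
by rewrite /Ind_at !Ind_0l subrr.
Qed.

(** The signs of F * G after a and before b, left over by the telescoping sum
    over the interior, cancel those in the two endpoint contributions. *)
Lemma cauchy_index_inversion (R : rcfType) (a b : R) (F G : {poly R}) :
  a < b -> F != 0 -> G != 0 ->
  ~~ (root F a && root G a) -> ~~ (root F b && root G b) ->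
  cauchy_index a b G F + cauchy_index a b F G = Var_between a b F G.
Proof.
move=> ab F0 G0 nFGa nFGb; have FG0 : F * G != 0 by rewrite mulf_neq0.
rewrite (cauchy_indexE _ _ _ FG0 F0) ?dvdp_mulIl //.
rewrite (cauchy_indexE _ _ _ FG0 G0) ?dvdp_mulIr //.
have Ea := Ind_right_inversion F0 G0 nFGa.
have Eb := Ind_left_inversion F0 G0 nFGb.
have : \sum_(x <- roots (F * G) a b) Ind_at x G F
     + \sum_(x <- roots (F * G) a b) Ind_at x F G =
     2^-1 * (sign_before b (F * G) - sign_after a (F * G)).
  rewrite -big_split -sum_sign_jumps // mulr_sumr; apply: eq_bigr => x _.
  exact: Ind_at_inversion.
rewrite /Var_between; lra.
Qed.

(** * Sturm sequences *)

Lemma cauchy_index_rem (R : rcfType) (a b : R) (F G : {poly R}) :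
  F != 0 -> cauchy_index a b (- (G %% F)) F = - cauchy_index a b G F.
Proof.
move=> F0; have I x : (Ind_right x G F = Ind_right x (G %% F) F)
    * (Ind_left x G F = Ind_left x (G %% F) F).
  by rewrite {1 3}(divp_eq G F) !Ind_modulo.
rewrite !(cauchy_indexE _ _ _ F0 F0) // !Ind_opp // !I.
rewrite (eq_bigr (fun x => - Ind_at x G F)) => [|x _].
  by rewrite sumrN; ring.
by rewrite /Ind_at !Ind_opp // !I; ring.
Qed.

(** The recursion of [sturm_term] extends a sequence at its end, whereas the
    Euclidean induction removes its first term. *)
Lemma sturm_term_shift (R : rcfType) (P Q : {poly R}) (n : nat) :
  sturm_term P Q n.+1 = sturm_term Q (- (P %% Q)) n.
Proof.
have [m leM] := ubnP n; elim: m n leM => // m IH [|[|n]] // lt.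
rewrite -[LHS]/(- (sturm_term P Q n.+1 %% sturm_term P Q n.+2)).
by rewrite !IH // ltnW.
Qed.

Lemma cauchy_index_sturm (R : rcfType) (a b : R) (s : nat) (P Q : {poly R}) :
  a < b -> P != 0 ->
  ~~ (root P a && root Q a) -> ~~ (root P b && root Q b) ->
  (forall i, (1 <= i <= s)%N -> sturm_term P Q i != 0) ->
  sturm_term P Q s.+1 = 0 ->
  cauchy_index a b Q P =
    \sum_(0 <= i < s) Var_between a b (sturm_term P Q i) (sturm_term P Q i.+1).
Proof.
move=> ab; elim: s P Q => [|s IHs] P Q P0 na nb Sn0 S0.
  by rewrite big_geq // [Q]S0 /cauchy_index eqxx.
have Q0 : Q != 0 by apply: (Sn0 1%N).
have noroot x : ~~ (root P x && root Q x) ->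
    ~~ (root Q x && root (- (P %% Q)) x).
  apply: contra => /andP[rQ]; rewrite rootN rQ andbT => rR.
  rewrite /root (divp_eq P Q) hornerD hornerM.
  by rewrite (rootP rQ) (rootP rR) mulr0 addr0.
rewrite big_nat_recl // -cauchy_index_inversion //.
under eq_bigr => i _ do rewrite !(sturm_term_shift P Q).
rewrite -IHs ?noroot // => [|i|]; last 2 first.
- by rewrite -sturm_term_shift => /andP[_ lis]; apply: Sn0.
- by rewrite -sturm_term_shift.
by rewrite cauchy_index_rem // addrK.
Qed.

Theorem theorem8 (R : rcfType) (a b : R) (P Q : {poly R}) (S : seq {poly R})
  (hab : a < b)
  (hP : P != 0)
  (hdeg : (size Q < size P)%N)
  (ha : ~~ (root P a && root Q a))
  (hb : ~~ (root P b && root Q b))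
  (hS : is_sturm_seq P Q S) :
  cauchy_index a b Q P =
    \sum_(0 <= i < (size S).-1) Var_between a b S`_i S`_i.+1.
Proof.
case: hS => s [-> Sn0 S0]; rewrite size_mkseq.
rewrite (cauchy_index_sturm hab hP ha hb Sn0 S0).
by apply: eq_big_nat => i /andP[_ lis]; rewrite !nth_mkseq // ltnW.
Qed.
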